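(* Let $j,i$ be non-negative integers and $n$ a positive integer. For each positive divisor $d\mid n$ let $r_d$ be the remainder of $j$ modulo $d$, and let $C_j$ be the $j$-th Catalan number. Then $$^jM^i_n=\frac{1}{n}\left(C_j+\sum_{\substack{d\mid n, \\ \lfloor \frac{2j}{d} \rfloor = 2 \lfloor \frac{j}{d} \rfloor, \\ d \neq 1}} {{\lfloor \frac{2j}{d} \rfloor} \choose {\lfloor \frac{j}{d} \rfloor}}\sum_{0 \le s <d}{^{r_d}M^s_d}\, c_d(i-s)\;-\sum_{\substack{d\mid n, \\ j\equiv -1 \pmod d, \\ d\neq 1}}{{\lfloor \frac{2j}{d} \rfloor}\choose {\lfloor \frac{j}{d}\rfloor}} c_d(i-1) \right).$$
   Context: A word is a finite word over $\{0,1\}$ (the empty word included); $w_i$ is its $i$-th letter. A word is flat if it contains at least as many zeros as ones; it is a Dyck word if its first $k$ letters form a flat word for every $k$. The major index of a word $w$ of length $N$ is $m(w)=\sum_{1\le i<N,\ w_i=1,\ w_{i+1}=0} i$. For non-negative integers $j,i$ and a positive integer $n$, $^jM^i_n$ denotes the number of Dyck words $w$ containing exactly $j$ ones and $j$ zeros with $m(w)\equiv i \pmod n$. For an integer $l$ and positive integer $d$, the Ramanujan sum is $c_d(l)=\sum_{e\mid d,\ e\mid l}\mu(d/e)\,e$. *)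

(* Defs.v *)
From mathcomp Require Export all_boot all_order all_algebra.

Set Implicit Arguments.
Unset Strict Implicit.
Unset Printing Implicit Defensive.

Import GRing.Theory.

(* The letter 0 is [false] and the letter 1 is [true]. *)
Definition word := seq bool.

(* Letters are numbered from 1; the value at other positions is a dummy. *)
Definition letter (w : word) (i : nat) : bool := nth false w i.-1.

Definition flat (w : word) : bool := count_mem true w <= count_mem false w.

Definition dyck (w : word) : bool :=
  [forall k : 'I_(size w).+1, flat (take k w)].

Definition maj (w : word) : nat :=
  \sum_(1 <= i < size w | letter w i && ~~ letter w i.+1) i.

(* dyckM j i n is ^jM^i_n; a word with j ones and j zeros has length 2j. *)
Definition dyckM (j i n : nat) : nat :=
  #|[set w : (2 * j).-tuple bool |
      [&& dyck w, count_mem true w == j, count_mem false w == j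
        & maj w == i %[mod n]]]|.

(* The division is exact. *)
Definition catalan (j : nat) : nat := 'C(2 * j, j) %/ j.+1.

(* Only used for n > 0. *)
Definition moebius (n : nat) : int :=
  if all (fun p => logn p n == 1) (primes n)
  then ((-1) ^+ size (primes n))%R else 0%R.

Definition ramanujan (d : nat) (l : int) : int :=
  (\sum_(e <- divisors d | (e%:Z %| l)%Z) moebius (d %/ e) * e%:Z)%R.

(* Main.v *)
(* By a q-analogue of the ballot theorem, Dyck words with j ones and j zeros
   satisfy (MacMahon)
     sum_w q^(m(w)) = [2j, j]_q - q [2j, j+1]_q.
   Counting words with m(w) = i mod n is a finite Fourier inversion, which needs
   the value of this polynomial at each n-th root of unity x.  If x has order
   d > 1 and j = a d + r, the q-Lucas theorem gives 'C(2a, a) times the same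
   polynomial for r when 2 r < d, gives - 'C(2a+1, a) x when r = d - 1, and gives
   0 otherwise; at x = 1 it gives the Catalan number.  Grouping the roots of
   unity by their order produces the Ramanujan sums. *)
Require Import Defs.
From mathcomp Require Import all_boot all_order all_algebra.
From mathcomp Require Import all_field ring zify.

Set Implicit Arguments.
Unset Strict Implicit.
Unset Printing Implicit Defensive.

Import Order.TTheory GRing.Theory Num.Theory.

Local Open Scope ring_scope.

(** * q-binomial coefficients *)

(** Defined by the q-Pascal rule and not by a quotient of products, so that it makes sense at roots
    of unity, where denominators can vanish. *)
Fixpoint qbin (R : comNzRingType) (q : R) (n k : nat) : R :=
  match n, k with
  | _, 0 => 1
  | 0, _.+1 => 0
  | n'.+1, k'.+1 => qbin q n' k' + q ^+ k * qbin q n' k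
  end.

Section QBinomial.
Variables (R : comNzRingType) (q : R).
Local Notation B := (qbin q).

Lemma qbin0 n : B n 0 = 1. Proof. by case: n. Qed.

Lemma qbinS n k : B n.+1 k.+1 = B n k + q ^+ k.+1 * B n k.+1.
Proof. by []. Qed.

Lemma qbin_small n k : (n < k)%N -> B n k = 0.
Proof.
elim: n k => [|n IHn] [|k] //= lt_nk.
by rewrite !IHn ?mulr0 ?addr0 // ltnW.
Qed.

Lemma qbinn n : B n n = 1.
Proof. by elim: n => //= n ->; rewrite qbin_small // mulr0 addr0. Qed.

(** The mirror Pascal rule: expanding both sides by the defining rule reduces it to the previous
    row. *)
Lemma qbinSl n k : (k <= n)%N -> B n.+1 k.+1 = q ^+ (n - k) * B n k + B n k.+1.
Proof.
elim: n k => [|n IHn] [|k] le_kn //.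
- by rewrite qbinS /= expr0; ring.
- have := IHn 0%N isT; rewrite !subn0 !qbin0 [B n.+2 1]qbinS !qbin0 => E.
  by rewrite {1}E qbinS qbin0 expr1 exprS; ring.
rewrite ltnS in le_kn; rewrite qbinS subSS [B n.+1 k.+1 in RHS]qbinS.
have [-> | ne_kn] := eqVneq k n.
  rewrite subnn expr0 mul1r qbinS !(@qbin_small n.+1 n.+2) //.
  by rewrite mulr0 !addr0.
have lt_kn : (k < n)%N by rewrite ltn_neqAle ne_kn.
rewrite [B n.+1 k.+2 in RHS]qbinS (IHn k) // (IHn k.+1) //.
have -> : (n - k = (n - k.+1).+1)%N by rewrite subnSK.
by rewrite !exprS; ring.
Qed.

(** Reflection exchanges the two Pascal rules, so each side is expanded by one of them. *)
Lemma qbin_sym m n : B (m + n) m = B (m + n) n.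
Proof.
have [N] := ubnP (m + n); elim: N m n => // N IHN [|m] [|n] // lt_N.
- by rewrite qbin0 add0n qbinn.
- by rewrite qbin0 addn0 qbinn.
rewrite !addSn addnS in lt_N *; rewrite qbinS [RHS]qbinSl; last by lia.
have -> : ((m + n).+1 - n = m.+1)%N by lia.
have E1 := IHN m n.+1; have E2 := IHN m.+1 n.
rewrite addnS in E1; rewrite addSn in E2.
by rewrite E1 ?E2 1?addrC //; lia.
Qed.

(** Subtract [q ^+ k.+1] times the mirror Pascal rule from the defining one: the terms in [B n k.+1]
    cancel. *)
Lemma qbin_absorb n k : (1 - q ^+ k.+1) * B n.+1 k.+1 = (1 - q ^+ n.+1) * B n k.
Proof.
have [le_kn | lt_nk] := leqP k n; last by rewrite !qbin_small // !mulr0.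
rewrite mulrBl mul1r {1}qbinS qbinSl //.
have -> : (n.+1 = (n - k) + k.+1)%N by lia.
by rewrite [q ^+ (_ + _)]exprD; ring.
Qed.

(* The q-binomial counterpart of appending a letter to a word. *)
Lemma qbin_rec n k :
  B n.+2 k.+1 = B n.+1 k + B n.+1 k.+1 + (q ^+ n.+1 - 1) * B n k.
Proof.
have E : (q ^+ n.+1 - 1) * B n k = (q ^+ k.+1 - 1) * B n.+1 k.+1.
  by rewrite -opprB mulNr -qbin_absorb; ring.
by rewrite E qbinS; ring.
Qed.

(** The mirror rule produces two terms with factor [q ^+ a.+1], which cancel by the symmetry of row
    [2a + 1]. *)
Lemma qbin_central a :
  B (a + a).+2 a.+1 - q * B (a + a).+2 a.+2 =
  B (a + a).+1 a.+1 - q * B (a + a).+1 a.+2.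
Proof.
have Esym : B (a + a).+1 a = B (a + a).+1 a.+1.
  by have := qbin_sym a a.+1; rewrite addnS.
rewrite (@qbinSl (a + a).+1 a) 1?(@qbinSl (a + a).+1 a.+1); try lia.
have -> : ((a + a).+1 - a = a.+1)%N by lia.
have -> : ((a + a).+1 - a.+1 = a)%N by lia.
by rewrite Esym exprS; ring.
Qed.

End QBinomial.

Lemma qbin1 (R : comNzRingType) n k : qbin (1 : R) n k = 'C(n, k)%:R.
Proof.
elim: n k => [|n IHn] [|k] //=; rewrite ?qbin0 ?bin0 //.
by rewrite !IHn expr1n mul1r binS natrD addrC.
Qed.

(** * q-binomials at a primitive root of unity *)

Section PrimitiveRoot.
Variables (R : idomainType) (d : nat) (z : R).
Hypothesis z_prim : d.-primitive_root z.
Local Notation B := (qbin z).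

(** Since [z ^+ d = 1], absorption leaves [(1 - z ^+ k) * B d k = 0], whose first factor is nonzero
    for [0 < k < d]. *)
Lemma qbin_prim_order k : (0 < k < d)%N -> B d k = 0.
Proof.
have d_gt0 := prim_order_gt0 z_prim.
case: k => [|k] //= lt_kd; apply/eqP.
have := qbin_absorb z d.-1 k; rewrite prednK // (prim_expr_order z_prim).
rewrite subrr mul0r.
move/eqP; rewrite mulf_eq0 subr_eq0 eq_sym -(prim_order_dvd z_prim).
by rewrite gtnNdvd.
Qed.

(** Row [d] is 1, 0, ..., 0, 1, and the weights of the Pascal rule have period [d]; hence row
    [d + n] is row [n] plus its translate by [d]. *)
Lemma qbin_shift n k :
  B (d + n) k = B n k + (if (k < d)%N then 0 else B n (k - d)).
Proof.
have d_gt0 := prim_order_gt0 z_prim.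
elim: n k => [|n IHn] k.
  rewrite addn0; case: k => [|k]; first by rewrite !qbin0 d_gt0 addr0.
  case: ltngtP => [lt_kd | lt_dk | <-].
  - by rewrite qbin_prim_order //= addr0.
  - by rewrite !qbin_small ?addr0 //; lia.
  by rewrite qbinn subnn /= add0r.
rewrite addnS; case: k => [|k]; first by rewrite !qbin0 d_gt0 addr0.
rewrite !qbinS !IHn; have [lt_kd | lt_dk | def_d] := ltngtP k.+1 d.
- by ring.
- rewrite subSn // qbinS.
  have -> : z ^+ k.+1 = z ^+ (k - d).+1.
    by rewrite -(subnKC lt_dk) subSS addSnnS exprD
               (prim_expr_order z_prim) mul1r.
  by ring.
by rewrite def_d subnn !qbin0 (prim_expr_order z_prim); ring.
Qed.

(** The q-Lucas theorem: on the quotients [a] and [b], the shift by [d] acts as the ordinary Pascal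
    rule. *)
Lemma qbin_lucas a b r s : (r < d)%N -> (s < d)%N ->
  B (a * d + r) (b * d + s) = 'C(a, b)%:R * B r s.
Proof.
move=> lt_rd lt_sd; elim: a b => [|a IHa] [|b].
- by rewrite bin0 mul1r.
- by rewrite mul0r qbin_small //; lia.
- rewrite bin0 mulSn -addnA qbin_shift !add0n lt_sd addr0.
  by have := IHa 0%N; rewrite bin0 add0n.
rewrite mulSn -addnA qbin_shift IHa binS natrD mulrDl.
rewrite ifF; last by lia.
have -> : (b.+1 * d + s - d = b * d + s)%N by lia.
by rewrite IHa.
Qed.

End PrimitiveRoot.

(** * The major index on ballot words *)

Lemma dyck_rcons w x : dyck (rcons w x) = dyck w && flat (rcons w x).
Proof.
apply/forallP/andP => [dw | [/forallP dw fw] [k lt_k]].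
  split; last first.
    have := dw ord_max.
    by rewrite -[nat_of_ord _]/(size (rcons w x)) take_size.
  apply/forallP => -[k lt_k]; have lt_k' : (k < (size (rcons w x)).+1)%N.
    by rewrite size_rcons ltnW.
  by have := dw (Ordinal lt_k'); rewrite /= -cats1 takel_cat.
move: (lt_k); rewrite /= size_rcons !ltnS leq_eqVlt => /predU1P[-> | le_k].
  by rewrite -[(size w).+1](size_rcons w x) take_size.
by rewrite -cats1 takel_cat //; have := dw (Ordinal le_k).
Qed.

Lemma dyck_flat w : dyck w -> flat w.
Proof.
by move/forallP/(_ ord_max); rewrite -[nat_of_ord _]/(size w) take_size.
Qed.

Lemma count_bool (w : word) : (count_mem true w + count_mem false w = size w)%N.
Proof. by elim: w => //= [[|]] w <-; rewrite /=; lia. Qed.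

(** The only possible new descent is at the old end of the word. *)
Lemma maj_rcons w x :
  maj (rcons w x) = (maj w + (last false w && ~~ x) * size w)%N.
Proof.
rewrite /maj size_rcons; have [-> | w_gt0] := posnP (size w).
  by rewrite muln0 !big_geq.
rewrite big_mkcond big_nat_recr //= -big_mkcond /letter /=; congr addn.
  rewrite big_nat_cond [RHS]big_nat_cond; apply: eq_bigl => i.
  case: (boolP (1 <= i < size w)%N) => //= /andP[i_gt0 lt_i].
  by rewrite !nth_rcons lt_i; case: i i_gt0 lt_i => //= i _ /ltnW ->.
rewrite !nth_rcons prednK // leqnn ltnn eqxx nth_last.
by case: (_ && _); rewrite ?mul1n.
Qed.

(** Built by appending on the right, so that sums split according to the last letter. *)
Fixpoint words n : seq word :=
  if n is n'.+1 then
    [seq rcons w false | w <- words n'] ++ [seq rcons w true | w <- words n']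
  else [:: [::]].

Lemma mem_words n w : (w \in words n) = (size w == n).
Proof.
elim: n w => [|n IHn] w; first by rewrite inE -size_eq0.
case/lastP: w => [|w x].
  by rewrite mem_cat; apply/negP => /orP[] /mapP[[|? ?]].
have memr y : (rcons w x \in [seq rcons w y | w <- words n]) =
              (size w == n) && (x == y).
  rewrite -IHn; apply/mapP/andP => [[v vn /rcons_inj[-> ->]] // | [wn /eqP->]].
  by exists w.
rewrite mem_cat !memr size_rcons eqSS -andb_orr.
by case: (x) => /=; rewrite andbT.
Qed.

Lemma uniq_words n : uniq (words n).
Proof.
elim: n => //= n IHn.
rewrite cat_uniq !map_inj_uniq ?IHn => [|? ? /rcons_inj[] //|? ? /rcons_inj[] //].
rewrite andbT /=; apply/hasPn => _ /mapP[w _ ->].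
by apply/mapP => -[v _ /rcons_inj[]].
Qed.

Lemma big_words (V : nmodType) n (P : pred word) (F : word -> V) :
  \sum_(w : n.-tuple bool | P w) F w = \sum_(w <- words n | P w) F w.
Proof.
rewrite -(big_map (@tval n bool) P F).
apply: perm_big; apply: uniq_perm.
- by rewrite map_inj_uniq ?index_enum_uniq //; apply: val_inj.
- exact: uniq_words.
move=> w; rewrite mem_words; apply/mapP/idP => [[t _ ->] | sz_w].
  by rewrite size_tuple.
by exists (Tuple sz_w); rewrite ?mem_index_enum.
Qed.

Section MajorIndex.
Variables (R : comNzRingType) (q : R).

Definition majgf n (P : pred word) : R := \sum_(w <- words n | P w) q ^+ maj w.

(** The number of zeros is left free: unlike balanced words, these families are stable under
    deleting the last letter, up to a change of [b]. *)
Definition ballot b (w : word) := dyck w && (count_mem true w == b).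

(* Appending a zero to a word of length n ending in a one creates a descent at
   position n; this is the correction term. *)
Lemma majgfS n P : majgf n.+1 P =
  majgf n (fun w => P (rcons w true)) + majgf n (fun w => P (rcons w false))
  + (q ^+ n - 1) * majgf n (fun w => P (rcons w false) && last false w).
Proof.
rewrite /majgf big_cat !big_map /= addrC -addrA; congr (_ + _).
  by apply: eq_bigr => w _; rewrite maj_rcons andbF addn0.
rewrite mulr_sumr big_mkcondr -big_split /= [LHS]big_seq_cond [RHS]big_seq_cond.
apply: eq_bigr => w; rewrite mem_words => /andP[/eqP sz_w _].
rewrite maj_rcons andbT sz_w; case: last; rewrite ?addn0 ?addr0 //.
by rewrite mul1n exprD; ring.
Qed.

Lemma eq_majgf n (P Q : pred word) :
  (forall w, size w = n -> P w = Q w) -> majgf n P = majgf n Q.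
Proof.
move=> eqPQ; rewrite /majgf [LHS]big_seq_cond [RHS]big_seq_cond.
by apply: eq_bigl => w; rewrite mem_words; case: eqP => // /eqPQ->.
Qed.

Lemma majgf0 n P : (forall w, size w = n -> P w = false) -> majgf n P = 0.
Proof. by move/eq_majgf->; rewrite /majgf big_pred0_eq. Qed.

(** A one may be appended exactly when the zeros, [n - b] in number, exceed the ones. *)
Lemma ballot_rcons_true n b w : size w = n ->
  ballot b.+1 (rcons w true) = (b.*2 < n)%N && ballot b w.
Proof.
move=> sz_w; rewrite /ballot dyck_rcons /flat -cats1 !count_cat /= addn0.
have := count_bool w; rewrite sz_w addn0 addn1 eqSS => def_n.
case: (dyck w); rewrite ?andbF //= -{}def_n addn0.
by case: eqVneq => [<-|]; rewrite ?andbF // -addnn ltn_add2l.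
Qed.

Lemma ballot_rcons_false b w : ballot b (rcons w false) = ballot b w.
Proof.
rewrite /ballot dyck_rcons /flat -cats1 !count_cat /= addn0.
have [/dyck_flat|] := boolP (dyck w) => //=; rewrite /flat => fw.
by rewrite addn0 addn1 leqW.
Qed.

(** Deleting a final one destroys no descent, so the weight is unchanged. This evaluates the
    correction term of [majgfS]. *)
Lemma majgf_last b n :
  majgf n.+1 (fun w => ballot b.+1 w && last false w) =
  if (b.*2 < n)%N then majgf n (ballot b) else 0.
Proof.
rewrite majgfS (@majgf0 _ (fun w => _ (rcons w false) && _)); last first.
  by move=> w _; rewrite last_rcons andbF.
rewrite [X in _ * X]majgf0; last by move=> w _; rewrite last_rcons andbF.
rewrite mulr0 !addr0; case: ifP => b_n.
  by apply: eq_majgf => w /ballot_rcons_true->; rewrite b_n last_rcons andbT.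
by apply: majgf0 => w /ballot_rcons_true->; rewrite b_n.
Qed.

(** Only the word of zeros counts, and it has no descent. *)
Lemma majgf_ballot0 n : majgf n (ballot 0) = 1.
Proof.
elim: n => [|n IHn].
  rewrite /majgf big_cons big_nil /= /ballot ifT.
    by rewrite /maj big_geq ?addr0.
  by rewrite eqxx andbT; apply/forallP => k.
rewrite majgfS majgf0 => [|w _]; last first.
  by rewrite /ballot -cats1 count_cat /= addn1 andbF.
rewrite [X in _ * X]majgf0 => [|w _].
  rewrite mulr0 add0r addr0 -{}[RHS]IHn.
  by apply: eq_majgf => w _; apply: ballot_rcons_false.
rewrite ballot_rcons_false; apply/negP => /andP[/andP[_ /eqP w0]].
case/lastP: w w0 => // w x; rewrite last_rcons -cats1 count_cat /= => + x_true.
by rewrite x_true addn1.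
Qed.

(* Both sides obey the recursion given by deleting the last letter; on the
   boundary [a = b], where the last letter must be a one, the two sides agree
   by the symmetry of the q-binomials. *)
Lemma majgf_ballot a b : majgf (a + b) (ballot b) =
  if (b <= a)%N then qbin q (a + b) a - q * qbin q (a + b) a.+1 else 0.
Proof.
have [N] := ubnP (a + b); elim: N a b => // N IHN a b lt_N.
case: leqP => [|lt_ab]; last first.
  apply: majgf0 => w sz_w; apply/negP => /andP[/dyck_flat fw /eqP def_b].
  by have := count_bool w; move: fw; rewrite /flat sz_w def_b; lia.
case: b lt_N => [_ _ | b lt_N].
  by rewrite addn0 majgf_ballot0 qbinn qbin_small // mulr0 subr0.
case: a lt_N => // a lt_N; rewrite ltnS => le_ba.
rewrite addSn addnS in lt_N *.
rewrite majgfS.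
have -> : majgf (a + b).+1 (fun w => ballot b.+1 (rcons w true)) =
          majgf (a.+1 + b) (ballot b).
  have b_n : (b.*2 < (a + b).+1)%N by lia.
  by rewrite addSn; apply: eq_majgf => w /ballot_rcons_true->; rewrite b_n.
have -> : majgf (a + b).+1 (fun w => ballot b.+1 (rcons w false)) =
          majgf (a + b.+1) (ballot b.+1).
  by rewrite addnS; apply: eq_majgf => w _; apply: ballot_rcons_false.
(* The bound [b.*2 < a + b] for a final one amounts to [b < a]. *)
have -> : majgf (a + b).+1
            (fun w => ballot b.+1 (rcons w false) && last false w) =
          if (b < a)%N then majgf (a + b) (ballot b) else 0.
  transitivity (majgf (a + b).+1 (fun w => ballot b.+1 w && last false w)).
    by apply: eq_majgf => w _; rewrite ballot_rcons_false.
  by rewrite majgf_last; congr (if _ then _ else _); lia.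
rewrite !IHN; try lia.
rewrite (leqW le_ba) le_ba; case: ltnP => [lt_ba | le_ab].
  rewrite addnS addSn [qbin q _.+2 a.+1]qbin_rec [qbin q _.+2 a.+2]qbin_rec.
  by ring.
have -> : b = a by lia.
by rewrite addSn qbin_central; ring.
Qed.

End MajorIndex.

(** * Divisors, the Moebius function and Ramanujan sums *)

(** Puts sums over divisors of different numbers on a common range, where they can be compared. *)
Lemma big_divisors (V : nmodType) m N (P : pred nat) (F : nat -> V) :
  (0 < m < N)%N ->
  \sum_(d <- divisors m | P d) F d = \sum_(0 <= d < N | (d %| m)%N && P d) F d.
Proof.
case/andP=> m_gt0 lt_mN; rewrite -big_filter_cond; apply: perm_big.
apply: uniq_perm; rewrite ?filter_uniq ?iota_uniq ?divisors_uniq // => d.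
rewrite mem_filter mem_iota -dvdn_divisors // subn0 add0n.
case: (boolP (d %| m)%N) => // /dvdn_leq le_dm.
by rewrite (leq_ltn_trans (le_dm _)).
Qed.

Lemma big_dvd (V : nmodType) f m (P : pred nat) (F : nat -> V) : (0 < f)%N ->
  \sum_(0 <= k < f * m | (f %| k)%N && P k) F k =
  \sum_(0 <= k < m | P (f * k)%N) F (f * k)%N.
Proof.
move=> f_gt0; rewrite -big_filter_cond -(big_map (muln f) P F).
apply: perm_big; apply: uniq_perm.
- by rewrite filter_uniq ?iota_uniq.
- rewrite map_inj_uniq ?iota_uniq // => x y /eqP.
  by rewrite eqn_pmul2l // => /eqP.
move=> k; rewrite mem_filter mem_iota subn0 add0n.
apply/andP/mapP => [[/dvdnP[x ->]] | [x + ->]].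
  by rewrite mulnC /= ltn_pmul2l // => lt_xm; exists x; rewrite ?mem_iota ?subn0.
by rewrite mem_iota subn0 add0n ltn_pmul2l // dvdn_mulr.
Qed.

(** If [p] divides [g], a square factor appears; otherwise exactly one prime is gained and the sign
    flips. *)
Lemma moebius_pM p g : prime p -> (0 < g)%N ->
  moebius (p * g) = if (p %| g)%N then 0 else - moebius g.
Proof.
move=> p_pr g_gt0; have p_gt0 := prime_gt0 p_pr.
have mem_pg q : (q \in primes (p * g)) = (q == p) || (q \in primes g).
  by rewrite primesM // (primes_prime p_pr) inE.
rewrite /moebius; case: (boolP (p %| g)%N) => p_g.
  rewrite ifF //; apply/negbTE/negP => /allP/(_ p).
  rewrite mem_pg eqxx => /(_ isT); rewrite lognM // logn_prime // eqxx.
  by rewrite add1n eqSS -leqn0 leqNgt logn_gt0 mem_primes p_pr g_gt0 p_g.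
have p_notin : p \notin primes g by rewrite mem_primes (negPf p_g) !andbF.
have perm : perm_eq (primes (p * g)) (p :: primes g).
  by apply: uniq_perm; rewrite /= ?p_notin ?primes_uniq.
rewrite (perm_all _ perm) (perm_size perm) /=.
rewrite lognM // logn_prime // eqxx lognE (negPf p_g) !andbF addn0 /=.
rewrite (@eq_in_all _ _ (fun q => logn q g == 1%N)) => [|q q_g].
  by case: ifP; rewrite ?oppr0 // exprS mulN1r.
rewrite lognM // logn_prime //; case: (q =P p) q_g p_notin => [-> -> // | _ _ _].
by rewrite add0n.
Qed.

(* For a prime p dividing m, the divisors f and p f with p not dividing f cancel,
   and the divisors divisible by p^2 contribute 0. *)
Lemma sum_moebius m : (0 < m)%N ->
  \sum_(f <- divisors m) moebius f = (m == 1%N)%:R.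
Proof.
move=> m_gt0; have [-> | m_neq1] := eqVneq m 1%N; first by rewrite big_seq1.
have [|p p_pr p_m] := @pdivP m; first by lia.
have p_gt0 := prime_gt0 p_pr.
have [m' def_m] : exists m', m = (p * m')%N.
  by case/dvdnP: p_m => m' ->; exists m'; rewrite mulnC.
have m'_gt0 : (0 < m')%N by move: m_gt0; rewrite def_m muln_gt0 => /andP[].
(* The range is a multiple of [p], so its multiples of [p] can be reindexed by [big_dvd]. *)
have m_bnd : (0 < m < p * m.+1)%N by rewrite m_gt0 /= leq_pmull.
rewrite (bigID (dvdn p)) /= !(@big_divisors _ _ (p * m.+1)) //.
rewrite (eq_bigl (fun d => (p %| d)%N && (d %| m)%N)) => [|d]; last exact: andbC.
rewrite big_dvd // big_mkcond /= (eq_bigr (fun g =>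
  if (g %| m)%N && ~~ (p %| g)%N then - moebius g else 0)) => [|g _]; last first.
  rewrite def_m dvdn_pmul2l //.
  case: (boolP (p %| g)%N) => p_g; rewrite ?andbF ?andbT; last first.
    rewrite Gauss_dvdr; last by rewrite coprime_sym prime_coprime.
    case: ifP => // /(dvdn_gt0 m'_gt0) g_gt0.
    by rewrite moebius_pM // (negPf p_g).
  case: ifP => // /(dvdn_gt0 m'_gt0) g_gt0.
  by rewrite moebius_pM // p_g.
by rewrite -big_mkcond sumrN -!big_divisors ?addNr ?m_gt0 ?ltnSn //;
  case/andP: m_bnd.
Qed.

(** * Power sums over roots of unity *)

Section RootsOfUnity.
Variables (F : fieldType).

Lemma prim_root_exprz_eq1 d (z : F) (l : int) : d.-primitive_root z ->
  (z ^ l == 1) = (d %| l)%Z.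
Proof.
move=> z_prim; rewrite dvdzE /= (prim_order_dvd z_prim).
by case: l => n //=; rewrite NegzE -exprnN invr_eq1.
Qed.

(** Orthogonality: a geometric series of ratio [z ^ l], which is 1 exactly when [d] divides [l]. *)
Lemma sum_prim_root d (z : F) (l : int) : d.-primitive_root z ->
  \sum_(0 <= k < d) (z ^+ k) ^ l = if (d %| l)%Z then d%:R else 0.
Proof.
move=> z_prim; rewrite (eq_bigr (fun k => (z ^ l) ^+ k)) => [|k _]; last first.
  exact: (exprzAC z k l).
rewrite -(prim_root_exprz_eq1 l z_prim); case: eqP => [-> | /eqP zl_neq1].
  rewrite (eq_bigr (fun=> 1)) => [|k _]; last by rewrite expr1n.
  by rewrite sumr_const_nat subn0.
rewrite big_mkord; apply: (mulfI (_ : z ^ l - 1 != 0)); first by rewrite subr_eq0.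
rewrite -subrX1 mulr0 -[_ ^+ d](exprzAC z d l) -exprnP.
by rewrite (prim_expr_order z_prim) exp1rz subrr.
Qed.

(** Identifies the divisor sum with the classical sum of [l]-th powers of the primitive [d]-th roots
    of unity. *)
Lemma ramanujan_prim_root d (z : F) (l : int) : d.-primitive_root z ->
  \sum_(0 <= k < d | coprime k d) (z ^+ k) ^ l = (ramanujan d l)%:~R.
Proof.
move=> z_prim; have d_gt0 := prim_order_gt0 z_prim.
have quoK f : (f %| d)%N -> (d %/ (d %/ f) = f)%N.
  case/dvdnP=> g def_d; have := d_gt0; rewrite def_d muln_gt0.
  by case/andP=> g_gt0 f_gt0; rewrite mulnK // mulKn.
(* Coprimality of [k] and [d] is detected by summing the Moebius function over the divisors of their
   gcd. *)
transitivity (\sum_(f <- divisors d) \sum_(0 <= k < d | (f %| k)%N)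
                (moebius f)%:~R * (z ^+ k) ^ l).
  rewrite (exchange_big_dep predT) //= big_mkcond; apply: eq_bigr => k _.
  rewrite -mulr_suml -(rmorph_sum intr) /=.
  have -> : \sum_(f <- divisors d | (f %| k)%N) moebius f =
            \sum_(f <- divisors (gcdn k d)) moebius f.
    rewrite !(@big_divisors _ _ d.+1) ?ltnSn ?d_gt0 //.
      by apply: eq_bigl => f; rewrite andbT dvdn_gcd andbC.
    by rewrite gcdn_gt0 d_gt0 orbT ltnS dvdn_leq // dvdn_gcdr.
  rewrite sum_moebius ?gcdn_gt0 ?d_gt0 ?orbT // /coprime.
  by case: eqP => _; rewrite ?mul1r ?mul0r.
rewrite /ramanujan rmorph_sum /=.
(* The definition is indexed by the complementary divisor [e = d / f]. *)
have quo_perm : perm_eq (divisors d) [seq (d %/ e)%N | e <- divisors d].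
  apply: uniq_perm => [||e]; rewrite ?map_inj_in_uniq ?divisors_uniq //.
    by move=> e f; rewrite -!dvdn_divisors // => /quoK{2}<- /quoK{2}<- ->.
  rewrite -dvdn_divisors //; apply/idP/mapP => [e_d | [f]].
    by exists (d %/ e)%N; rewrite ?quoK // -dvdn_divisors // dvdn_div.
  by rewrite -dvdn_divisors // => f_d ->; apply: dvdn_div.
rewrite (perm_big _ quo_perm) big_map /= [RHS]big_mkcond big_seq [RHS]big_seq.
apply: eq_bigr => e; rewrite -dvdn_divisors // => e_d.
have quo_gt0 : (0 < d %/ e)%N.
  by rewrite divn_gt0 ?(dvdn_leq d_gt0 e_d) // (dvdn_gt0 d_gt0 e_d).
rewrite -mulr_sumr.
have -> : \sum_(0 <= k < d | (d %/ e %| k)%N) (z ^+ k) ^ l =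
          \sum_(0 <= k < e) ((z ^+ (d %/ e)) ^+ k) ^ l.
  rewrite [RHS](eq_bigr (fun k => (z ^+ (d %/ e * k)) ^ l)) => [|k _];
    last by rewrite -exprM.
  rewrite -(@big_dvd F (d %/ e) e xpredT (fun k => (z ^+ k) ^ l)) // divnK //.
  by apply: eq_bigl => k; rewrite andbT.
rewrite (sum_prim_root l (dvdn_prim_root z_prim e_d)).
by case: ifP; rewrite ?mulr0 // rmorphM.
Qed.

(** Each fraction [k / n] has a unique lowest form with denominator [d = n / gcd(k, n)]; for powers
    of a primitive [n]-th root, [d] is the order. *)
Lemma big_coprime_quotients (V : nmodType) n (G : nat -> V) : (0 < n)%N ->
  \sum_(0 <= k < n) G k =
  \sum_(d <- divisors n) \sum_(0 <= k < d | coprime k d) G (n %/ d * k)%N.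
Proof.
move=> n_gt0; transitivity (\sum_(0 <= k < n)
    \sum_(d <- divisors n | d == (n %/ gcdn k n)%N) G k).
  apply: eq_bigr => k _; rewrite -big_filter filter_pred1_uniq ?divisors_uniq //.
    by rewrite big_seq1.
  by rewrite -dvdn_divisors // dvdn_div ?dvdn_gcdr.
rewrite (exchange_big_dep predT) //= big_seq [RHS]big_seq; apply: eq_bigr => d.
rewrite -dvdn_divisors // => d_n; have d_gt0 := dvdn_gt0 n_gt0 d_n.
have [c def_n] : exists c, n = (c * d)%N by case/dvdnP: d_n => c ->; exists c.
have c_gt0 : (0 < c)%N by move: n_gt0; rewrite def_n muln_gt0 => /andP[].
rewrite def_n mulnK //.
transitivity (\sum_(0 <= k < c * d | (c %| k)%N && coprime (k %/ c) d) G k).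
  apply: eq_bigl => k; apply/eqP/andP => [def_d | [/dvdnP[k' ->]]].
    have gcd_c : gcdn k (c * d) = c.
      have /divnK := dvdn_gcdr k (c * d); rewrite -def_d mulnC => /eqP.
      by rewrite eqn_pmul2r // => /eqP.
    have c_k : (c %| k)%N by rewrite -gcd_c dvdn_gcdl.
    split=> //; have /eqP := gcd_c; rewrite -{1}(divnK c_k) mulnC -muln_gcdr.
    by rewrite -{3}[c]muln1 eqn_pmul2l.
  rewrite mulnK // [(k' * c)%N]mulnC -muln_gcdr => /eqnP->.
  by rewrite muln1 mulKn.
rewrite (@big_dvd V c d (fun k => coprime (k %/ c) d)) //.
by apply: eq_bigl => k; rewrite mulKn.
Qed.

End RootsOfUnity.

(** * Dyck words at roots of unity *)

Lemma ramanujanN d l : ramanujan d (- l) = ramanujan d l.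
Proof. by apply: eq_bigl => e; rewrite !dvdzE abszN. Qed.

(** At [q = 1] the value is ['C(2j, j) - 'C(2j, j+1)], and [j+1] times this difference is
    ['C(2j, j)]. *)
Lemma majgf_catalan (R : comNzRingType) j :
  majgf (1 : R) (j + j) (ballot j) = (catalan j)%:R.
Proof.
rewrite majgf_ballot leqnn !qbin1 mul1r /catalan mul2n -addnn.
have E : (j.+1 * 'C(j + j, j.+1) = j * 'C(j + j, j))%N.
  by rewrite mul_bin_left addnK.
have le_bin : ('C(j + j, j.+1) <= 'C(j + j, j))%N.
  by rewrite -(leq_pmul2l (ltn0Sn j)) E leq_mul2r leqnSn orbT.
rewrite -natrB //; congr _%:R.
rewrite -[LHS](@mulKn _ j.+1) //; congr (_ %/ _)%N.
by rewrite mulnBr E -mulnBl subSnn mul1n.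
Qed.

(** Apply q-Lucas to both q-binomials with [j = a d + r]; everything depends on whether doubling [r]
    carries past [d]. *)
Lemma majgf_prim_root (R : idomainType) d (x : R) j :
  d.-primitive_root x -> d != 1%N ->
  majgf x (j + j) (ballot j) =
    (if ((2 * j) %/ d == 2 * (j %/ d))%N then
       'C((2 * j) %/ d, j %/ d)%:R * majgf x (j %% d + j %% d)%N (ballot (j %% d)%N)
     else 0)
    - (if (j%:Z == -1 %[mod d])%Z then 'C((2 * j) %/ d, j %/ d)%:R * x else 0).
Proof.
move=> x_prim d_neq1; have d_gt0 := prim_order_gt0 x_prim.
have d_gt1 : (1 < d)%N by rewrite ltn_neqAle eq_sym d_neq1.
rewrite !majgf_ballot !leqnn.
have -> : (j%:Z == -1 %[mod d])%Z = (j %% d == d.-1)%N.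
  rewrite eqz_mod_dvd opprK -PoszD addn1 dvdzE /= {1}(divn_eq j d) -addnS.
  rewrite dvdn_addr ?dvdn_mull //; apply/idP/eqP => [/dvdn_leq | ->].
    by have := ltn_pmod j d_gt0; lia.
  by rewrite prednK.
have := divn_eq j d; have := ltn_pmod j d_gt0.
move: (j %/ d)%N (j %% d)%N => a r lt_rd ->.
have [lt_2r | ge_2r] := ltnP (r + r) d.
  have def2 : (a * d + r + (a * d + r) = (a + a) * d + (r + r))%N by lia.
  rewrite mul2n -addnn def2 divnMDl // divn_small // addn0 mul2n -addnn eqxx.
  (* As [d > 1], [r + r < d] excludes [r = d.-1]. *)
  rewrite ifF ?subr0; last by lia.
  rewrite (qbin_lucas x_prim) // -(addnS (a * d) r).
  rewrite (qbin_lucas x_prim) //; last by lia.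
  by ring.
have def2 : (a * d + r + (a * d + r) = (a + a).+1 * d + (r + r - d))%N by lia.
rewrite mul2n -addnn def2 divnMDl // divn_small ?addn0; last by lia.
rewrite mul2n -addnn ifF; last by lia.
rewrite (qbin_lucas x_prim) //; last by lia.
(* After a carry the upper residue [r + r - d] is below [r], so the first q-binomial vanishes. *)
rewrite (@qbin_small _ _ (r + r - d)) ?mulr0; last by lia.
have [def_r | neq_r] := eqVneq r d.-1; last first.
  rewrite -(addnS (a * d) r) (qbin_lucas x_prim) //; try lia.
  by rewrite (@qbin_small _ _ (r + r - d)) ?mulr0 //; lia.
(* Here [j + 1] is a multiple of [d]: its residue is 0 and the second q-binomial survives. *)
have -> : ((a * d + r).+1 = a.+1 * d + 0)%N by lia.
rewrite (qbin_lucas x_prim) //; last by lia.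
rewrite qbin0 mulr1 mulrC; congr (_ - _%:R * _).
by rewrite -(@bin_sub _ a.+1); [congr 'C(_, _); lia | lia].
Qed.

(** In a word of length [2j], having [j] ones forces [j] zeros. *)
Lemma dyckM_words (R : pzSemiRingType) j i n : (dyckM j i n)%:R =
  \sum_(w <- words (j + j) | ballot j w && (maj w == i %[mod n])) 1 :> R.
Proof.
rewrite addnn -mul2n.
transitivity (\sum_(w <- words (2 * j) | [&& dyck w, count_mem true w == j,
                count_mem false w == j & maj w == i %[mod n]]) 1 : R).
  rewrite /dyckM -sum1_card natr_sum; etransitivity; last exact: big_words.
  by apply: eq_bigl => w; rewrite inE.
rewrite big_seq_cond [RHS]big_seq_cond; apply: eq_bigl => w; rewrite mem_words.
rewrite /ballot -andbA; case: eqP => // sz_w.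
case: eqP => //= def_j; rewrite ?andbF //.
by have := count_bool w; rewrite sz_w def_j mul2n -addnn => /addnI->; rewrite eqxx.
Qed.

(** The power [x ^+ maj w] depends only on [maj w] modulo [n]. *)
Lemma majgf_dyckM (R : comNzRingType) (x : R) j n : (0 < n)%N -> x ^+ n = 1 ->
  majgf x (j + j) (ballot j) = \sum_(0 <= s < n) (dyckM j s n)%:R * x ^+ s.
Proof.
move=> n_gt0 xn1.
under eq_bigr => s _ do rewrite dyckM_words mulr_suml.
rewrite (exchange_big_dep (ballot j)) /= => [|s w _ /andP[] //].
rewrite /majgf; apply: eq_bigr => w bw; rewrite bw.
transitivity (\sum_(0 <= s < n | s == (maj w %% n)%N) 1 * x ^+ s).
  rewrite -big_filter filter_pred1_uniq ?iota_uniq //.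
    by rewrite big_seq1 mul1r expr_mod.
  by rewrite mem_iota subn0 add0n ltn_mod.
rewrite [LHS]big_nat_cond [RHS]big_nat_cond; apply: eq_bigl => s.
by case: ltnP; rewrite ?andbF //= => lt_sn; rewrite (modn_small lt_sn) eq_sym.
Qed.

(** Orthogonality keeps exactly the words for which [n] divides [maj w - i]; this difference may be
    negative, hence integer exponents. *)
Lemma dyckM_fourier (F : fieldType) (z : F) j i n : n.-primitive_root z ->
  n%:R * (dyckM j i n)%:R =
  \sum_(0 <= k < n) majgf (z ^+ k) (j + j) (ballot j) * (z ^+ k) ^ (- i%:Z).
Proof.
move=> z_prim; have n_gt0 := prim_order_gt0 z_prim.
under [RHS]eq_bigr => k _ do rewrite mulr_suml.
rewrite exchange_big dyckM_words mulr_sumr big_mkcondr; apply: eq_bigr => w _.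
rewrite (eq_bigr (fun k => (z ^+ k) ^ ((maj w)%:Z - i%:Z))) => [|k _]; last first.
  rewrite exprzDr // unitrX // -(unitrX_pos _ n_gt0).
  by rewrite (prim_expr_order z_prim) unitr1.
by rewrite (sum_prim_root _ z_prim) -eqz_mod_dvd !modz_nat mulr1.
Qed.

Theorem theorem5p16 (j i n : nat) (n_gt0 : (0 < n)%N) :
  (dyckM j i n)%:R =
    n%:R^-1 *
    ((catalan j)%:R
     + \sum_(d <- divisors n | ((2 * j) %/ d == 2 * (j %/ d))%N && (d != 1%N))
         'C((2 * j) %/ d, j %/ d)%:R *
         (\sum_(0 <= s < d)
            (dyckM (j %% d) s d)%:R * (ramanujan d (i%:Z - s%:Z))%:~R)
     - \sum_(d <- divisors n | (j%:Z == -1 %[mod d])%Z && (d != 1%N))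
         'C((2 * j) %/ d, j %/ d)%:R * (ramanujan d (i%:Z - 1))%:~R) :> rat.
Proof.
have [z z_prim] := C_prim_root_exists n_gt0.
have n_neq0 : n%:R != 0 :> rat by rewrite pnatr_eq0 -lt0n.
apply: (mulfI n_neq0); rewrite mulVKf //.
(* The identity is checked in [algC], which contains the root [z] and into which the rationals
   embed. *)
apply: (fmorph_inj (ratr : {rmorphism rat -> algC})).
rewrite rmorphM /= !ratr_nat (dyckM_fourier j i z_prim) big_coprime_quotients //.
(* The divisor 1 stands for the root 1, which gives the Catalan number. *)
rewrite -addrA (bigD1_seq 1%N) ?divisors_uniq -?dvdn_divisors //=.
rewrite [RHS]rmorphD /= ratr_nat; congr (_ + _).
  rewrite divn1 big_mkcond big_nat1 coprimen1 muln0 expr0 majgf_catalan.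
  by rewrite exp1rz mulr1.
(* Both divisor sums are merged into one over [d != 1], to be compared term by term. *)
rewrite [RHS]rmorphB /= !rmorph_sum /= big_mkcondl [X in _ = _ - X]big_mkcondl /=.
rewrite -sumrB big_seq_cond [RHS]big_seq_cond; apply: eq_bigr => d.
rewrite -dvdn_divisors // => /andP[d_n d_neq1].
have d_gt0 := dvdn_gt0 n_gt0 d_n.
have := dvdn_prim_root z_prim d_n; set y := z ^+ _ => y_prim.
have yk_prim k : coprime k d -> d.-primitive_root (y ^+ k).
  by rewrite prim_root_exp_coprime.
have yk_unit k : y ^+ k \is a GRing.unit.
  by rewrite unitrX // -(unitrX_pos _ d_gt0) (prim_expr_order y_prim) unitr1.
(* The case conditions depend on [d] only, so they come out of the sum over the roots [y ^+ k] of
   order [d]. *)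
rewrite (eq_bigr (fun k =>
    (if ((2 * j) %/ d == 2 * (j %/ d))%N then
       'C((2 * j) %/ d, j %/ d)%:R * (\sum_(0 <= s < d)
         (dyckM (j %% d) s d)%:R * (y ^+ k) ^ (s%:Z - i%:Z))
     else 0)
    - (if (j%:Z == -1 %[mod d])%Z then
         'C((2 * j) %/ d, j %/ d)%:R * (y ^+ k) ^ (1 - i%:Z) else 0)))
  => [|k k_d]; last first.
  rewrite exprM -/y (majgf_prim_root j (yk_prim k k_d) d_neq1) mulrBl.
  rewrite (majgf_dyckM (j %% d) d_gt0 (prim_expr_order (yk_prim k k_d))).
  congr (_ - _); case: ifP => _; rewrite ?mul0r // -mulrA; congr (_ * _).
    by rewrite mulr_suml; apply: eq_bigr => s _; rewrite -mulrA exprzDr.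
  by rewrite exprzDr.
(* The exponent is [s - i]; evenness of Ramanujan sums turns it into [i - s]. *)
have sum_ram c s : \sum_(0 <= k < d | coprime k d) c * (y ^+ k) ^ (s - i%:Z) =
    c * (ramanujan d (i%:Z - s))%:~R.
  by rewrite -mulr_sumr (ramanujan_prim_root _ y_prim) -ramanujanN opprB.
rewrite sumrB; congr (_ - _).
  case: ifP => _; last exact: big1_eq.
  rewrite -mulr_sumr exchange_big /= rmorphM rmorph_sum /= ratr_nat.
  congr (_ * _); apply: eq_bigr => s _.
  by rewrite sum_ram rmorphM /= ratr_nat ratr_int.
case: ifP => _; last exact: big1_eq.
by rewrite sum_ram rmorphM /= ratr_nat ratr_int.
Qed.
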